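(* There are at most nine lines in Euclidean three-space which are pairwise at distance one. That is, if $\mathcal{F}$ is a set of lines in $\mathbb{R}^3$ such that $d(\ell,\ell')=1$ for all distinct $\ell,\ell'\in\mathcal{F}$, then $\mathcal{F}$ has at most nine elements.
   Context: A line in $\mathbb{R}^3$ is a set $\ell=\mathbb{R}l+p=\{\lambda l+p : \lambda\in\mathbb{R}\}$ with $p,l\in\mathbb{R}^3$ and $l\neq 0$. The distance between two lines $\ell,\ell'$ is $d(\ell,\ell'):=\inf\{\|p-p'\|_2 : p\in\ell,\ p'\in\ell'\}$, where $\|\cdot\|_2$ is the Euclidean norm. Lines are allowed to be parallel. *)

(* Defs.v *)
From mathcomp Require Import all_boot all_order all_algebra.
From mathcomp Require Import all_classical all_reals.

Set Implicit Arguments.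
Unset Strict Implicit.
Unset Printing Implicit Defensive.

Import Order.TTheory GRing.Theory Num.Theory.
Local Open Scope classical_set_scope.
Local Open Scope ring_scope.

(* The norm `|v| that MathComp-Analysis puts on row vectors is the sup norm,
   hence a separate Euclidean norm. *)
Definition norm2 (R : realType) (n : nat) (v : 'rV[R]_n) : R :=
  Num.sqrt (\sum_(i < n) v ord0 i ^+ 2).

Definition is_line (R : realType) (L : set 'rV[R]_3) : Prop :=
  exists p l : 'rV[R]_3, l != 0 /\ L = [set t *: l + p | t in [set: R]].

Definition line_dist (R : realType) (L L' : set 'rV[R]_3) : R :=
  inf [set norm2 (p - p') | p in L & p' in L'].

(* Main.v *)
Require Import Defs.
From mathcomp Require Import all_boot all_order all_algebra.
From mathcomp Require Import all_classical all_reals.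
From mathcomp Require Import ring lra zify.

(** Represent a line by a unit direction [l] and the moment [m = p x l] of one
    of its points, that is, by a Plücker vector [x] in dimension 6, with the
    Plücker form [l . m' + m . l'] of signature (3, 3). Two lines are at
    distance 1 when the square of this form is [1 - (l . l') ^ 2], apart from
    an extra condition when they are parallel, and for [x' = x] this equation
    still holds. Suppose that there are ten such lines.

    The upper bound. The equation says that the symmetric squares [x^T x] are
    mutually orthogonal and isotropic for a quadratic form on symmetric matrices
    of size 6 with negative index 9. An isotropic subspace has dimension at most
    9, so the ten squares satisfy a linear relation ([touching_dependency]).
    Read as a matrix equation, the relation makes the coordinate vectors of the
    lines in its support isotropic for a nondegenerate diagonal form, so these
    lines have rank at most half their number ([isotropic_rank]).

    The lower bound. Between nonparallel lines the Plücker form is plus or minus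
    the sine of the angle, and the sine is, up to a constant factor, the
    Euclidean distance between the orthogonal projections onto the two
    directions. Distance matrices of distinct points are strictly negative
    definite on sum-zero vectors ([sqrt_strict_neg_type]). So k lines for which
    all signs are positive, after reversal of some lines, give a negative
    definite subspace of dimension k - 1, and likewise for negative signs. This
    gives k <= 4 and makes the rank large when there are large sets of both
    kinds ([coherent_rank]). Ramsey's theorem provides these sets, and the rank
    of n <= 10 lines always exceeds n / 2 ([rank_lower]).

    The two bounds contradict each other ([no_ten_skew]), provided that no two
    of the lines are parallel. If two are, all lines are parallel to the plane
    of these two, and then there are at most six lines ([no_parallel]). *)

Set Implicit Arguments.
Unset Strict Implicit.
Unset Printing Implicit Defensive.

Import Order.TTheory GRing.Theory Num.Theory.

(** * Ramsey numbers *)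

Section Ramsey.
Context {n : nat}.
Implicit Types (r : rel 'I_n) (V A : {set 'I_n}).

(** The restriction to distinct vertices lets complementation act on colours:
    the loops that it creates are ignored. *)
Definition clique r A : Prop := {in A &, forall x y, x != y -> r x y}.

Definition codual r : rel 'I_n := fun x y => ~~ r x y.

(** The arrow relation of Ramsey theory for the two-colouring of the pairs of
    [V] by [r] and [codual r], with both cliques allowed to be prescribed. *)
Definition arrows V r p q : Prop :=
  (exists A, [/\ A \subset V, #|A| = p & clique r A]) \/
  (exists A, [/\ A \subset V, #|A| = q & clique (codual r) A]).

Lemma arrows_codual V r p q : arrows V (codual r) q p -> arrows V r p q.
Proof.
case=> -[A [AV Ac cA]]; [right|left]; exists A; split=> // x y xA yA xy.
by have := cA x y xA yA xy; rewrite /codual negbK.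
Qed.

Lemma codual_arrows V r p q : arrows V r p q -> arrows V (codual r) q p.
Proof.
case=> -[A [AV Ac cA]]; [right|left]; exists A; split=> // x y xA yA xy.
by rewrite /codual negbK cA.
Qed.

Lemma clique1 r x : clique r [set x].
Proof. by move=> a b /set1P-> /set1P->; rewrite eqxx. Qed.

Lemma clique_cons r x A : symmetric r -> {in A, forall y, r x y} -> clique r A ->
  clique r (x |: A).
Proof.
move=> sr rx cA a b /setU1P[->|aA] /setU1P[->|bA]; rewrite ?eqxx // => ab.
- exact: rx.
- by rewrite sr rx.
- exact: cA.
Qed.

Definition nbrs r V x := [set y in V | (y != x) && r x y].

Lemma arrows_nbrs r V x p q : symmetric r -> x \in V ->
  arrows (nbrs r V x) r p q -> arrows V r p.+1 q.
Proof.
move=> sr xV; case=> -[A [AV Ac cA]]; last first.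
  right; exists A; split=> //; apply: fintype.subset_trans AV _.
  by apply/fintype.subsetP => y; rewrite inE => /andP[].
left; exists (x |: A); split.
- apply/fintype.subsetP => y /setU1P[->//|/(fintype.subsetP AV)]; by rewrite inE => /andP[].
- rewrite cardsU1 Ac; suff -> : x \notin A by [].
  by apply/negP => /(fintype.subsetP AV); rewrite inE eqxx andbF.
- apply: clique_cons => // y /(fintype.subsetP AV); by rewrite inE => /and3P[].
Qed.

Lemma arrows_conbrs r V x p q : symmetric r -> x \in V ->
  arrows (nbrs (codual r) V x) r p q -> arrows V r p q.+1.
Proof.
move=> sr xV H; apply: arrows_codual; apply: (arrows_nbrs (x := x)) => //.
  by move=> a b; rewrite /codual sr.
exact: codual_arrows.
Qed.

Lemma card_nbrs r V x : x \in V ->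
  (#|nbrs r V x| + #|nbrs (codual r) V x|).+1 = #|V|.
Proof.
move=> xV; rewrite (cardsD1 x V) xV add1n; congr S.
rewrite -(cardsID [set y | r x y] (V :\ x)); congr (_ + _); apply: eq_card => y;
 by rewrite !inE /codual; case: (y \in V); case: (y == x); case: (r x y).
Qed.

(** The handshake lemma: each edge is counted from its smaller and from its
    larger end. *)
Lemma sum_nbrs_even r V : symmetric r -> ~~ odd (\sum_(x in V) #|nbrs r V x|).
Proof.
move=> sr.
have -> : \sum_(x in V) #|nbrs r V x| =
   \sum_(x in V) \sum_(y in V) ((x < y) && r x y) +
   \sum_(x in V) \sum_(y in V) ((y < x) && r x y).
  rewrite -big_split; apply: eq_bigr => x xV /=.
  rewrite -big_split /= -sum1_card.
  rewrite (eq_bigl (fun y => (y \in V) && ((y != x) && r x y))); last by move=> y; rewrite inE.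
  rewrite big_mkcondr; apply: eq_bigr => y _ /=.
  by rewrite -val_eqE neq_ltn; case: (ltngtP x y) => //=; case: (r x y).
rewrite [X in _ + X]exchange_big /=.
under [X in _ + X]eq_bigr do under eq_bigr do rewrite sr.
by rewrite addnn odd_double.
Qed.

Lemma subset_of_card k V : k <= #|V| ->
  exists2 W : {set 'I_n}, W \subset V & #|W| = k.
Proof.
move=> kV; exists [set x in take k (enum V)].
  by apply/fintype.subsetP => x; rewrite inE => /mem_take; rewrite mem_enum.
rewrite cardsE (card_uniqP _) ?take_uniq ?enum_uniq // size_take -cardE.
by case: ltngtP kV.
Qed.

Lemma arrows_subset r V (W : {set _}) p q : W \subset V -> arrows W r p q -> arrows V r p q.
Proof.
by move=> WV [] [A [AW Ac cA]]; [left|right]; exists A; split=> //; apply: fintype.subset_trans WV.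
Qed.

(** The Erdős–Szekeres recursion, from the neighbours of any one vertex. *)
Lemma ramsey_step r a b p q : symmetric r ->
  (forall V, a <= #|V| -> arrows V r p q.+1) ->
  (forall V, b <= #|V| -> arrows V r p.+1 q) ->
  0 < a + b -> forall V, a + b <= #|V| -> arrows V r p.+1 q.+1.
Proof.
move=> sr ha hb ab V hV.
have /card_gt0P[x xV] : 0 < #|V| by lia.
have := card_nbrs r xV; have [h _|h c] := leqP a #|nbrs r V x|.
  by apply: (arrows_nbrs sr xV); apply: ha.
by apply: (arrows_conbrs sr xV); apply: hb; lia.
Qed.

(** When both bounds are even, one vertex fewer suffices: were neither colour
    neighbourhood ever large enough, every vertex would have exactly [a.-1]
    neighbours, an odd number of vertices of odd degree. *)
Lemma ramsey_step_even r a b p q : symmetric r -> ~~ odd a -> ~~ odd b ->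
  (forall V, a <= #|V| -> arrows V r p q.+1) ->
  (forall V, b <= #|V| -> arrows V r p.+1 q) ->
  0 < a -> forall V, (a + b).-1 <= #|V| -> arrows V r p.+1 q.+1.
Proof.
move=> sr oa ob ha hb a0 V0 /subset_of_card[V VV0 hV].
apply: arrows_subset VV0 _.
have [/existsP[x /andP[xV]]|] := boolP [exists x in V, a <= #|nbrs r V x|].
  by move=> h; apply: (arrows_nbrs sr xV); apply: ha.
rewrite negb_exists => /forallP hlt.
have [/existsP[x /andP[xV]]|] := boolP [exists x in V, b <= #|nbrs (codual r) V x|].
  by move=> h; apply: (arrows_conbrs sr xV); apply: hb.
rewrite negb_exists => /forallP hlt'.
have := sum_nbrs_even V sr.
rewrite (eq_bigr (fun=> a.-1)) => [|x xV].
  by rewrite sum_nat_const hV oddM; lia.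
have := card_nbrs r xV; have := hlt x; have := hlt' x; rewrite xV hV /=.
move: #|nbrs r V x| #|nbrs (codual r) V x| => s t; lia.
Qed.

Lemma ramsey_1 r q V : 0 < #|V| -> arrows V r 1 q.
Proof.
move=> /card_gt0P[x xV]; left; exists [set x]; rewrite finset.sub1set xV cards1.
by split=> //; apply: clique1.
Qed.

Lemma ramsey_2 r q V : symmetric r -> 0 < q -> q <= #|V| -> arrows V r 2 q.
Proof.
move=> sr; elim: q V => [//|[|q] IH] V _ hV.
  by apply: arrows_codual; apply: ramsey_1.
rewrite -add1n in hV; apply: (@ramsey_step r 1 q.+1) hV => //.
- by move=> W; apply: ramsey_1.
- by move=> W; apply: IH.
Qed.

Lemma ramsey_33 r V : symmetric r -> 6 <= #|V| -> arrows V r 3 3.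
Proof.
move=> sr; apply: (@ramsey_step r 3 3) => // W hW; first exact: ramsey_2.
apply: arrows_codual; apply: ramsey_2 => //.
by move=> a b; rewrite /codual sr.
Qed.

Lemma ramsey_34 r V : symmetric r -> 9 <= #|V| -> arrows V r 3 4.
Proof.
move=> sr; apply: (@ramsey_step_even r 4 6) => // W hW; first exact: ramsey_2.
exact: ramsey_33.
Qed.
End Ramsey.

Local Open Scope ring_scope.

(** * Distances are strictly of negative type *)

Section NegativeType.
Context {R : realType} {T : finType}.
Implicit Types (K L : T -> T -> R) (u : T -> R).

Definition quad K u : R := \sum_i \sum_j u i * u j * K i j.

Definition psd K : Prop := forall u, 0 <= quad K u.

(** Kernels whose entrywise product with every positive semidefinite kernel is
    again positive semidefinite. By the Schur product theorem these are
    the positive semidefinite kernels. In this form, closure under products and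
    under pointwise limits is immediate, and the theorem itself is reduced to
    Gram kernels, where the form splits into forms of [L] ([schur_gram]). *)
Definition schur K : Prop := forall L, psd L -> psd (fun i j => K i j * L i j).

Lemma eq_quad K L u : K =2 L -> quad K u = quad L u.
Proof. by move=> KL; apply: eq_bigr => i _; apply: eq_bigr => j _; rewrite KL. Qed.

Lemma quadD K L u : quad (fun i j => K i j + L i j) u = quad K u + quad L u.
Proof.
rewrite /quad -big_split; apply: eq_bigr => i _ /=.
by rewrite -big_split; apply: eq_bigr => j _ /=; rewrite mulrDr.
Qed.

Lemma quadZ a K u : quad (fun i j => a * K i j) u = a * quad K u.
Proof.
rewrite /quad mulr_sumr; apply: eq_bigr => i _.
by rewrite mulr_sumr; apply: eq_bigr => j _; rewrite mulrCA.
Qed.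

Lemma quad_sum d (K : 'I_d -> T -> T -> R) u :
  quad (fun i j => \sum_a K a i j) u = \sum_a quad (K a) u.
Proof.
symmetry; rewrite /quad exchange_big; apply: eq_bigr => i _ /=.
by rewrite exchange_big; apply: eq_bigr => j _ /=; rewrite mulr_sumr.
Qed.

Lemma quad_rank1 f u : quad (fun i j => f i * f j) u = (\sum_i u i * f i) ^+ 2.
Proof.
rewrite /quad expr2 mulr_suml; apply: eq_bigr => i _.
by rewrite mulr_sumr; apply: eq_bigr => j _; ring.
Qed.

Lemma eq_schur K L : K =2 L -> schur K -> schur L.
Proof.
move=> KL sK N pN u; rewrite -(@eq_quad (fun i j => K i j * N i j)) ?sK //.
by move=> i j; rewrite KL.
Qed.

Lemma schur0 : schur (fun _ _ => 0).
Proof.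
by move=> L _ u; rewrite (eq_quad (L := fun i j => 0 * L i j)) // quadZ mul0r.
Qed.

Lemma schurD K L : schur K -> schur L -> schur (fun i j => K i j + L i j).
Proof.
move=> sK sL N pN u.
have /eq_quad-> : (fun i j => (K i j + L i j) * N i j) =2
    (fun i j => K i j * N i j + L i j * N i j) by move=> i j; rewrite mulrDl.
by rewrite quadD addr_ge0 ?sK ?sL.
Qed.

Lemma schurM K L : schur K -> schur L -> schur (fun i j => K i j * L i j).
Proof.
move=> sK sL N pN u.
have /eq_quad-> : (fun i j => (K i j * L i j) * N i j) =2
    (fun i j => K i j * (L i j * N i j)) by move=> i j; rewrite mulrA.
exact/sK/sL.
Qed.

Lemma schurZ a K : 0 <= a -> schur K -> schur (fun i j => a * K i j).
Proof.
move=> a0 sK N pN u.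
have /eq_quad-> : (fun i j => (a * K i j) * N i j) =2
    (fun i j => a * (K i j * N i j)) by move=> i j; rewrite mulrA.
by rewrite quadZ mulr_ge0 ?sK.
Qed.

Lemma schur_gram d (f : 'I_d -> T -> R) :
  schur (fun i j => \sum_a f a i * f a j).
Proof.
move=> N pN u.
have /eq_quad-> : (fun i j => (\sum_a f a i * f a j) * N i j) =2
    (fun i j => \sum_a (f a i * f a j) * N i j) by move=> i j; rewrite mulr_suml.
rewrite quad_sum; apply: sumr_ge0 => a _.
have := pN (fun i => u i * f a i); rewrite /quad.
congr (_ <= _); apply: eq_bigr => i _; apply: eq_bigr => j _; ring.
Qed.

(** [sqrt_gap] is a fixed point of [x |-> (t + x ^ 2) / 2], and the iterates
    of this map from 0 are polynomials in [t] with nonnegative coefficients: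
    this replaces the binomial series of [1 - sqrt (1 - t)]. *)
Fixpoint root_approx (k : nat) (t : R) : R :=
  if k is k'.+1 then 2^-1 * (t + root_approx k' t * root_approx k' t) else 0.

Definition sqrt_gap (t : R) : R := 1 - Num.sqrt (1 - t).

Lemma sqrt_gapE t : 0 <= t <= 1 ->
  [/\ 0 <= sqrt_gap t <= 1, sqrt_gap t = 2^-1 * (t + sqrt_gap t * sqrt_gap t) &
    (t < 1 -> sqrt_gap t < 1)].
Proof.
move=> /andP[t0 t1]; rewrite /sqrt_gap.
have s2 := sqr_sqrtr (_ : 0 <= 1 - t).
have {}s2 : Num.sqrt (1 - t) ^+ 2 = 1 - t by apply: s2; lra.
have s0 := sqrtr_ge0 (1 - t).
split; [nra|nra|].
move=> lt1; have : 0 < Num.sqrt (1 - t) by rewrite sqrtr_gt0; lra.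
lra.
Qed.

(** With [m] the limit and [e] the error at one step, the next error is
    [e (m - e / 2)], which is at most [e (1 - e / 2)]; this is how the bound
    [2 / (k + 2)] propagates, uniformly in [t] although the iteration is not
    contracting at [t = 1]. *)
Lemma root_approx_error k t : 0 <= t <= 1 ->
  [/\ 0 <= root_approx k t, root_approx k t <= sqrt_gap t &
   sqrt_gap t - root_approx k t <= 2 / (k%:R + 2)].
Proof.
move=> t01; have [/andP[m0 m1] mE _] := sqrt_gapE t01.
case/andP: t01 => t0 t1.
elim: k => [|k [IH0 IH1 IH2]] /=.
  split=> //; rewrite subr0 add0r divff //; lra.
set a := root_approx k t in IH0 IH1 IH2 *.
set m := sqrt_gap t in m0 m1 mE IH1 IH2 *.
split; [nra|nra|].
have k0 : 0 <= k%:R :> R by [].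
rewrite -(natr1 k); move: (k%:R) k0 IH2 => K k0.
set d := 2 / (K + 2) => IH2.
have dE : d * (K + 2) = 2 by rewrite /d divfK //; lra.
have d1 : d <= 1 by rewrite /d ler_pdivrMr; lra.
have e_le : m - 2^-1 * (t + a * a) <= d * (1 - d / 2).
  have e0 : 0 <= m - a by rewrite subr_ge0.
  have h1 : m - 2^-1 * (t + a * a) = (m - a) * (m - (m - a) / 2).
    by rewrite {1}mE; field.
  have h2 : (m - a) * (m - (m - a) / 2) <= (m - a) * (1 - (m - a) / 2).
    by rewrite ler_wpM2l // lerD2r.
  have h3 : 0 <= (d - (m - a)) * (1 - (d + (m - a)) / 2).
    by rewrite mulr_ge0; lra.
  by rewrite h1; lra.
apply: (le_trans e_le).
rewrite ler_pdivlMr; last by lra.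
have -> : d * (1 - d / 2) * (K + 1 + 2) = (1 - d / 2) * (d * (K + 2) + d).
  by ring.
have d_gt0 : 0 < d by rewrite /d divr_gt0 //; lra.
by rewrite dE; nra.
Qed.

Lemma ge0_of_approx (x C : R) : 0 <= C ->
  (forall k : nat, - (C * (2 / (k%:R + 2))) <= x) -> 0 <= x.
Proof.
move=> C0 H; rewrite leNgt; apply/negP => x0.
have := archi_boundP (_ : 0 <= 2 * C / (- x)).
set k := Num.bound _ => /(_ _) kP.
have {}kP : 2 * C / - x < k%:R by apply: kP; rewrite divr_ge0 //; lra.
have := H k; rewrite lerNl mulrA ler_pdivlMr; last first.
  by apply: (@lt_le_trans _ _ 2) => //; rewrite lerDr.
move: kP; rewrite ltr_pdivrMr; last by lra.
nra.
Qed.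

Lemma schur_sqrt_gap K : (forall i j, 0 <= K i j <= 1) -> schur K ->
  schur (fun i j => sqrt_gap (K i j)).
Proof.
move=> K01 sK L pL u.
have sA k : schur (fun i j => root_approx k (K i j)).
  elim: k => [|k IH] /=; first exact: schur0.
  by apply: schurZ; [lra|apply: schurD => //; apply: schurM].
pose C := \sum_i \sum_j `|u i * u j * L i j|.
apply: (@ge0_of_approx _ C) => [|k].
  by apply: sumr_ge0 => i _; apply: sumr_ge0 => j _.
have := sA k L pL u; set q := quad _ _; set q' := quad _ _ => q0.
suff : q - q' <= C * (2 / (k%:R + 2)) by lra.
rewrite /q /q' /quad /C mulr_suml -sumrB; apply: ler_sum => i _.
rewrite mulr_suml -sumrB; apply: ler_sum => j _.
have [a0 a1 a2] := root_approx_error k (K01 i j).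
set a := root_approx _ _ in a0 a1 a2 *; set m := sqrt_gap _ in a1 a2 *.
have -> : u i * u j * (a * L i j) - u i * u j * (m * L i j)
   = (u i * u j * L i j) * (a - m) by ring.
apply: (le_trans (ler_norm _)); rewrite normrM ler_wpM2l //.
by rewrite distrC ger0_norm ?subr_ge0.
Qed.

Lemma psd_const1 : psd (fun _ _ => 1).
Proof.
move=> u; have /eq_quad-> : (fun _ _ : T => 1 : R) =2 (fun i j => (fun=> 1) i * (fun=> 1) j).
  by move=> i j; rewrite mulr1.
by rewrite quad_rank1 sqr_ge0.
Qed.

Lemma psd_pow K k : schur K -> psd (fun i j => K i j ^+ k).
Proof.
move=> sK; elim: k => [|k IH] u /=.
  have := psd_const1 u; congr (_ <= _); apply: eq_quad => i j; by rewrite expr0.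
by have := sK _ IH u; congr (_ <= _); apply: eq_quad => i j; rewrite exprS.
Qed.

(** Multiply the entrywise identity [2 M = K + M ^ 2] by powers of [M]: both
    terms on the right stay positive semidefinite. So where the quadratic form
    of [M] vanishes, those of all entrywise powers of [M] vanish, hence those of
    all polynomials in [M] without constant term. One of these polynomials is
    zero on the entries off the diagonal and not on the diagonal. *)
Lemma sqrt_gap_pd K u : (forall i j, 0 <= K i j <= 1) -> schur K ->
  (forall i, K i i = 1) -> (forall i j, i != j -> K i j < 1) ->
  quad (fun i j => sqrt_gap (K i j)) u <= 0 -> forall i, u i = 0.
Proof.
move=> K01 sK K1 Klt q0.
set M := fun i j => sqrt_gap (K i j) in q0.
have sM : schur M by apply: schur_sqrt_gap.
have Mii i : M i i = 1 by rewrite /M /sqrt_gap K1 subrr sqrtr0 subr0.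
have Mlt i j : i != j -> M i j < 1.
  by move=> /Klt; have [_ _] := sqrt_gapE (K01 i j).
have qpow k : quad (fun i j => M i j ^+ k.+1) u = 0.
  elim: k => [|k IH].
    apply/eqP; rewrite eq_le; apply/andP; split; last exact: psd_pow.
    by move: q0; congr (_ <= _); apply: eq_quad => i j; rewrite expr1.
  apply/eqP; rewrite eq_le; apply/andP; split; last exact: psd_pow.
  have : quad (fun i j => M i j ^+ k.+1) u =
     2^-1 * (quad (fun i j => K i j * M i j ^+ k) u + quad (fun i j => M i j ^+ k.+2) u).
    rewrite -quadD -quadZ; apply: eq_quad => i j.
    have [_ mE _] := sqrt_gapE (K01 i j).
    by rewrite exprSr {2}/M mE -/(M i j) !exprSr; ring.
  rewrite IH; have := sK _ (psd_pow k sM) u; lra.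
have qpoly (p : {poly R}) : quad (fun i j => ('X * p).[M i j]) u = 0.
  have /eq_quad-> : (fun i j => ('X * p).[M i j]) =2
      (fun i j => \sum_(a < size p) p`_a * M i j ^+ a.+1).
    move=> i j; rewrite hornerM hornerX horner_coef mulr_sumr.
    by apply: eq_bigr => a _; rewrite exprS mulrCA.
  by rewrite quad_sum big1 // => a _; rewrite quadZ qpow mulr0.
pose p : {poly R} := \prod_(x : T * T | x.1 != x.2) ('X - (M x.1 x.2)%:P).
have p1 : p.[1] != 0.
  rewrite horner_prod; apply/prodf_neq0 => -[i j] /= ij.
  by rewrite hornerXsubC subr_eq0 gt_eqF ?Mlt.
have := qpoly p; rewrite /quad.
have -> : \sum_i \sum_j u i * u j * ('X * p).[M i j] = p.[1] * \sum_i u i ^+ 2.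
  rewrite mulr_sumr; apply: eq_bigr => i _.
  rewrite (bigD1 i) //= big1 ?addr0; last first.
    move=> j ji; rewrite hornerM (_ : p.[M i j] = 0) ?mulr0 //.
    rewrite horner_prod (bigD1 (i, j)) /=; last by rewrite eq_sym.
    by rewrite hornerXsubC subrr mul0r.
  by rewrite Mii hornerM hornerX; ring.
move/eqP; rewrite mulf_eq0 (negPf p1) /= psumr_eq0; last by move=> i _; exact: sqr_ge0.
by move=> /allP H i; have := H i (mem_index_enum i); rewrite sqrf_eq0 => /eqP.
Qed.

(** A case of Schoenberg's theorem that Euclidean distances are strictly of
    negative type: [1 - K i j] is half of the squared distance of two unit
    vectors with Gram matrix [K]. *)
Lemma sqrt_strict_neg_type K u : (forall i j, 0 <= K i j <= 1) -> schur K ->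
  (forall i, K i i = 1) -> (forall i j, i != j -> K i j < 1) ->
  \sum_i u i = 0 -> 0 <= quad (fun i j => Num.sqrt (1 - K i j)) u ->
  forall i, u i = 0.
Proof.
move=> K01 sK K1 Klt u0 q0; apply: (@sqrt_gap_pd K) => //.
have : quad (fun i j => sqrt_gap (K i j)) u + quad (fun i j => Num.sqrt (1 - K i j)) u
  = (\sum_i u i * 1) ^+ 2.
  rewrite -quad_rank1 -quadD; apply: eq_quad => i j; rewrite /sqrt_gap; ring.
under eq_bigr do rewrite mulr1.
rewrite u0 expr0n /=; lra.
Qed.
End NegativeType.

(** * Dot products and linear dependence *)

Section Dot.
Context {R : realType} {d : nat}.
Implicit Types u v w : 'rV[R]_d.

Definition dot u v : R := \sum_k u 0 k * v 0 k.

Lemma dotC u v : dot u v = dot v u.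
Proof. by apply: eq_bigr => k _; rewrite mulrC. Qed.

Lemma dotDl u v w : dot (u + v) w = dot u w + dot v w.
Proof. by rewrite /dot -big_split; apply: eq_bigr => k _; rewrite mxE mulrDl. Qed.

Lemma dotZl a u v : dot (a *: u) v = a * dot u v.
Proof. by rewrite /dot mulr_sumr; apply: eq_bigr => k _; rewrite mxE mulrA. Qed.

Lemma dotDr u v w : dot u (v + w) = dot u v + dot u w.
Proof. by rewrite dotC dotDl !(dotC u). Qed.

Lemma dotZr a u v : dot u (a *: v) = a * dot u v.
Proof. by rewrite dotC dotZl dotC. Qed.

Lemma dotNl u v : dot (- u) v = - dot u v.
Proof. by rewrite -scaleN1r dotZl mulN1r. Qed.

Lemma dotNr u v : dot u (- v) = - dot u v.
Proof. by rewrite dotC dotNl dotC. Qed.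

Lemma dot0l v : dot 0 v = 0.
Proof. by rewrite -(scale0r 0) dotZl mul0r. Qed.

Lemma dot_suml (I : finType) (f : I -> 'rV[R]_d) v :
  dot (\sum_i f i) v = \sum_i dot (f i) v.
Proof.
by rewrite (big_morph (dot^~ v) (id1 := 0) (op1 := +%R)) ?dot0l // => x y;
  rewrite dotDl.
Qed.

Lemma dot_sumr (I : finType) (f : I -> 'rV[R]_d) v :
  dot v (\sum_i f i) = \sum_i dot v (f i).
Proof. by rewrite dotC dot_suml; apply: eq_bigr => i _; rewrite dotC. Qed.

Definition dotE := (dotDl, dotDr, dotNl, dotNr, dotZl, dotZr).

Lemma dot_ge0 u : 0 <= dot u u.
Proof. by apply: sumr_ge0 => k _; rewrite -expr2 sqr_ge0. Qed.

Lemma dot_eq0 u : (dot u u == 0) = (u == 0).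
Proof.
apply/idP/eqP => [|->]; last by rewrite dot0l.
rewrite psumr_eq0 => [/allP u0|k _]; last by rewrite -expr2 sqr_ge0.
apply/rowP => k; have := u0 k (mem_index_enum k).
by rewrite mulf_eq0 orbb mxE => /eqP.
Qed.

Lemma dot_mx u v : u *m v^T = (dot u v)%:M.
Proof.
apply/matrixP => i j; rewrite !ord1 mxE mxE eqxx mulr1n.
by apply: eq_bigr => k _; rewrite mxE.
Qed.

Lemma dot_sqr_le1 u v : dot u u = 1 -> dot v v = 1 -> dot u v ^+ 2 <= 1.
Proof.
move=> u1 v1; have := dot_ge0 (v - dot u v *: u).
by rewrite !dotE u1 v1 (dotC v u); nra.
Qed.

Lemma bessel2 u w v : dot u u = 1 -> dot w w = 1 -> dot w u = 0 -> dot v v = 1 ->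
  dot w v ^+ 2 + dot u v ^+ 2 <= 1.
Proof.
move=> u1 w1 wu v1; have := dot_ge0 (v - dot w v *: w - dot u v *: u).
by rewrite !dotE u1 w1 v1 (dotC u w) wu !(dotC v); nra.
Qed.

End Dot.

Lemma row_dependency (F : fieldType) n k (M : 'M[F]_(n, k)) :
  (\rank M < n)%N -> exists2 c : 'rV_n, c != 0 & c *m M = 0.
Proof.
move=> rM; have : kermx M != 0 by rewrite -mxrank_eq0 mxrank_ker -lt0n subn_gt0.
move=> k0; exists (nz_row (kermx M)); first by rewrite nz_row_eq0.
by apply/sub_kermxP; apply: nz_row_sub.
Qed.

Lemma affine_dependency (F : fieldType) n k (v : 'I_n -> 'rV[F]_k) :
  (\rank (\matrix_i row_mx (1%:M : 'M_1) (v i)) < n)%N ->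
  exists2 c : 'rV_n, c != 0 & \sum_i c 0 i = 0 /\ \sum_i c 0 i *: v i = 0.
Proof.
move=> /row_dependency[c c0 cM]; exists c => //.
have cM' : \sum_i c 0 i *: row_mx (1%:M : 'M_1) (v i) = 0.
  rewrite mulmx_sum_row in cM; rewrite -[RHS]cM.
  by apply: eq_bigr => i _; rewrite rowK.
split.
  have := congr1 (fun z : 'rV_(1 + k) => lsubmx z 0 0) cM'.
  rewrite linear_sum summxE linear0 mxE => E; rewrite -[RHS]E.
  by apply: eq_bigr => i _; rewrite linearZ /= row_mxKl !mxE mulr1.
have := congr1 (fun z : 'rV_(1 + k) => rsubmx z) cM'.
rewrite linear_sum linear0 => E; rewrite -[RHS]E.
by apply: eq_bigr => i _; rewrite /= scale_row_mx row_mxKr.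
Qed.

Lemma rank_row_mx_le (F : fieldType) n a b (A : 'M[F]_(n, a)) (B : 'M_(n, b)) :
  (\rank (row_mx A B) <= \rank A + \rank B)%N.
Proof.
have -> : row_mx A B = row_mx A 0 + row_mx 0 B by rewrite add_row_mx addr0 add0r.
by apply: leq_trans (mxrank_add _ _) _; rewrite rank_row_mx0 rank_row_0mx.
Qed.

Section Spread.
Context {R : realType} {n : nat} (A : {set 'I_n}) (c : 'rV[R]_#|A|).

(** Extension by zero of coefficients indexed by the enumeration of [A]. *)
Definition spread (i : 'I_n) : R := \sum_(k | enum_val k == i) c 0 k.

Lemma spread_val k : spread (enum_val k) = c 0 k.
Proof.
rewrite /spread (bigD1 k) //= big1 ?addr0 // => j /andP[/eqP/enum_val_inj->].
by rewrite eqxx.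
Qed.

Lemma spread_out i : i \notin A -> spread i = 0.
Proof.
move=> iA; rewrite /spread big1 // => k /eqP ki.
by move: iA; rewrite -ki enum_valP.
Qed.

Lemma spread_eq0 : (forall i, spread i = 0) -> c = 0.
Proof. by move=> s0; apply/rowP => k; rewrite -spread_val s0 mxE. Qed.

Lemma sum_spread (V : lmodType R) (f : 'I_n -> V) :
  \sum_i spread i *: f i = \sum_k c 0 k *: f (enum_val k).
Proof.
rewrite /spread; under eq_bigr do rewrite scaler_suml.
rewrite (exchange_big_dep xpredT) //=; apply: eq_bigr => k _.
rewrite (bigD1 (enum_val k)) //= big1 ?addr0 // => j /andP[/eqP->].
by rewrite eqxx.
Qed.

Lemma spread_sum : \sum_i spread i = \sum_k c 0 k.
Proof.
have := sum_spread (fun=> 1 : R^o).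
under eq_bigr do rewrite /GRing.scale /= mulr1.
by under [in RHS]eq_bigr do rewrite /GRing.scale /= mulr1.
Qed.
End Spread.

(** * Coherent sets of lines *)

Section Lines.
Context {R : realType} {n : nat} (l m : 'I_n -> 'rV[R]_3).

(** The Plücker form of two lines with directions [l i], [l j] and moments
    [m i], [m j] about the origin. For unit directions its absolute value is
    the distance of the lines times the sine of their angle. *)
Definition moment i j : R := dot (l i) (m j) + dot (m i) (l j).

Definition plucker : 'M[R]_(n, 3 + 3) := \matrix_i row_mx (l i) (m i).

(** For lines at distance 1, [moment i j] is plus or minus the sine of the
    angle. The last equation also holds for [i = j], where it says that
    [0 = 1 - 1]: the isotropy argument uses it on the diagonal. *)
Definition touching : Prop :=
  [/\ forall i, dot (l i) (l i) = 1, forall i, dot (l i) (m i) = 0 &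
      forall i j, moment i j ^+ 2 = 1 - dot (l i) (l j) ^+ 2].

(** For touching lines this says that no two of them are parallel. *)
Definition skew : Prop := forall i j, i != j -> moment i j != 0.

(** After reversal of the lines with [sg i = -1], all Plücker products in [A]
    have the same sign [e]. *)
Definition coherent (e : R) (sg : 'I_n -> R) (A : {set 'I_n}) : Prop :=
  (forall i, sg i ^+ 2 = 1) /\
  forall i j, i \in A -> j \in A -> i != j ->
    sg i * sg j * moment i j = e * Num.sqrt (1 - dot (l i) (l j) ^+ 2).

Context (tch : touching) (skw : skew).

Lemma momentC i j : moment i j = moment j i.
Proof. by rewrite /moment addrC !(dotC (l _)). Qed.

(** On sum-zero combinations of a coherent set, the Plücker form is a matrix
    of sines up to the sign [e]. The sine is, up to a constant, the distance of
    the projections onto the lines, so strict negative type makes the form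
    definite, of sign [- e]. *)
Lemma coherent_definite e sg A (u : 'I_n -> R) : coherent e sg A ->
  (forall i, i \notin A -> u i = 0) -> \sum_i u i = 0 -> e ^+ 2 = 1 ->
  0 <= e * dot (\sum_i (u i * sg i) *: l i) (\sum_i (u i * sg i) *: m i) ->
  forall i, u i = 0.
Proof.
move=> [sg2 coh] uA u0 e2 q0; have [l1 lm am] := tch.
apply: (@sqrt_strict_neg_type _ _ (fun i j => dot (l i) (l j) ^+ 2)) => //.
- by move=> i j; rewrite sqr_ge0 dot_sqr_le1.
- have sD : schur (fun i j => dot (l i) (l j)).
    exact: (@schur_gram _ _ _ (fun a i => l i 0 a)).
  by apply: eq_schur (schurM sD sD) => i j; rewrite expr2.
- by move=> i; rewrite l1 expr1n.
- move=> i j /skw; rewrite -sqrf_eq0 am => h.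
  by rewrite lt_neqAle dot_sqr_le1 // andbT; apply: contraNneq h => ->; rewrite subrr.
set D := dot _ _ in q0.
suff -> : quad (fun i j => Num.sqrt (1 - dot (l i) (l j) ^+ 2)) u = 2 * (e * D) by lra.
have -> : 2 * (e * D) = e * \sum_i \sum_j (u i * sg i) * (u j * sg j) * moment i j.
  have D1 : D = \sum_i \sum_j (u i * sg i) * (u j * sg j) * dot (l i) (m j).
    rewrite /D dot_suml; apply: eq_bigr => i _; rewrite dot_sumr.
    by apply: eq_bigr => j _; rewrite dotZl dotZr mulrA.
  have D2 : D = \sum_i \sum_j (u i * sg i) * (u j * sg j) * dot (m i) (l j).
    rewrite D1 exchange_big /=; apply: eq_bigr => i _; apply: eq_bigr => j _.
    by rewrite dotC; ring.
  have -> : \sum_i \sum_j (u i * sg i) * (u j * sg j) * moment i j = D + D.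
    rewrite {1}D1 D2 -big_split; apply: eq_bigr => i _ /=.
    by rewrite -big_split; apply: eq_bigr => j _ /=; rewrite mulrDr.
  by ring.
rewrite mulr_sumr; apply: eq_bigr => i _; rewrite mulr_sumr; apply: eq_bigr => j _.
have [<-|ij] := eqVneq i j.
  by rewrite l1 expr1n subrr sqrtr0 /moment (dotC (m i)) lm addr0 !mulr0.
have [iA|/uA ->] := boolP (i \in A); last by rewrite !mul0r mulr0.
have [jA|/uA ->] := boolP (j \in A); last by rewrite !(mul0r, mulr0).
transitivity (u i * u j * e * (sg i * sg j * moment i j)); last by ring.
by rewrite coh // mulrA -(mulrA _ e e) -expr2 e2 mulr1.
Qed.

(** The Plücker form has signature (3, 3). Concretely, five coherent lines have
    a sum-zero combination with [l = e m], where the form has the sign of [e]. *)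
Lemma coherent_le4 e sg A : e ^+ 2 = 1 -> coherent e sg A -> (#|A| <= 4)%N.
Proof.
move=> e2 coh; rewrite leqNgt; apply/negP => A4.
pose f i := sg i *: (l i - e *: m i).
have [|c c0 [c1 cf]] := @affine_dependency _ _ _ (fun k : 'I_#|A| => f (enum_val k)).
  by apply: leq_ltn_trans (rank_leq_col _) A4.
suff /spread_eq0 c00 : forall i, spread c i = 0 by rewrite c00 eqxx in c0.
apply: (coherent_definite coh) => //.
- exact: spread_out.
- by rewrite spread_sum.
- have := sum_spread c f; rewrite cf.
  have -> : \sum_i spread c i *: f i =
     \sum_i (spread c i * sg i) *: l i - e *: \sum_i (spread c i * sg i) *: m i.
    rewrite scaler_sumr -sumrB; apply: eq_bigr => i _.
    by rewrite /f scalerA scalerBr; congr (_ - _); rewrite !scalerA mulrC.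
  move/eqP; rewrite subr_eq0 => /eqP->.
  by rewrite dotZl mulrA -expr2 e2 mul1r dot_ge0.
Qed.

(** The sum-zero combinations of the two sets span subspaces of dimensions
    [#|P| - 1] and [#|N| - 1] on which the form is negative, respectively
    positive, definite. The form is computed from the Plücker vectors,
    so these subspaces map injectively to the span of those vectors, and their
    images meet only in 0. *)
Lemma coherent_rank sg tu P N : coherent 1 sg P -> coherent (-1) tu N ->
  (#|P| + #|N| <= 2 + \rank plucker)%N.
Proof.
move=> cohP cohN; rewrite leqNgt; apply/negP => big.
(* The two extra columns of [M] force the coefficients on [P], and those
   on [N], to have sum zero. *)
pose SP : 'M[R]_(#|P|, n) := \matrix_k (sg (enum_val k) *: delta_mx 0 (enum_val k)).
pose SN : 'M[R]_(#|N|, n) := \matrix_k (tu (enum_val k) *: delta_mx 0 (enum_val k)).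
pose B : 'M[R]_(#|P| + #|N|, 1 + 1) := block_mx (const_mx 1) 0 0 (const_mx 1).
pose M := row_mx B (col_mx SP SN *m plucker).
have [|c c0] := @row_dependency _ _ _ M.
  apply: leq_ltn_trans (rank_row_mx_le _ _) _; apply: leq_ltn_trans big.
  by apply: leq_add; [exact: rank_leq_col | exact: mxrankM_maxr].
rewrite -[c]hsubmxK in c0 *; set cP := lsubmx c in c0 *; set cN := rsubmx c in c0 *.
rewrite mul_mx_row => /eqP; rewrite row_mx_eq0 => /andP[/eqP cB /eqP cX].
have [sP sN] : \sum_k cP 0 k = 0 /\ \sum_k cN 0 k = 0.
  move: cB; rewrite /B mul_row_block !mulmx0 addr0 add0r => /eqP.
  rewrite row_mx_eq0 => /andP[/eqP/matrixP/(_ 0 0) h1 /eqP/matrixP/(_ 0 0) h2].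
  move: h1 h2; rewrite !mxE => h1 h2.
  split; [rewrite -[RHS]h1|rewrite -[RHS]h2]; apply: eq_bigr => k _;
    by rewrite [const_mx _ _ _]mxE mulr1.
have sprd (A : {set 'I_n}) (c' : 'rV[R]_#|A|) (s : 'I_n -> R) :
   c' *m (\matrix_k (s (enum_val k) *: delta_mx 0 (enum_val k))) *m plucker =
   row_mx (\sum_i (spread c' i * s i) *: l i) (\sum_i (spread c' i * s i) *: m i).
  rewrite -mulmxA (_ : _ *m plucker =
    \matrix_k (s (enum_val k) *: row (enum_val k) plucker)); last first.
    by apply/row_matrixP => k; rewrite row_mul !rowK -scalemxAl -rowE ?rowK.
  rewrite mulmx_sum_row.
  have -> : \sum_i (spread c' i * s i) *: l i = \sum_i spread c' i *: (s i *: l i).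
    by apply: eq_bigr => i _; rewrite scalerA.
  have -> : \sum_i (spread c' i * s i) *: m i = \sum_i spread c' i *: (s i *: m i).
    by apply: eq_bigr => i _; rewrite scalerA.
  rewrite !sum_spread.
  rewrite -[LHS]hsubmxK !linear_sum; congr row_mx; apply: eq_bigr => k _;
   by rewrite linearZ /= !rowK linearZ /= ?row_mxKl ?row_mxKr.
move: cX; rewrite mulmxA mul_row_col mulmxDl !sprd add_row_mx => /eqP.
rewrite row_mx_eq0 => /andP[/eqP/(canRL (addrK _)) lE /eqP/(canRL (addrK _)) mE].
rewrite !sub0r in lE mE.
have onesq : (1 : R) ^+ 2 = 1 by rewrite expr1n.
have mone : (-1 : R) ^+ 2 = 1 by rewrite sqrrN expr1n.
set lN := \sum_i (spread cN i * tu i) *: l i in lE.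
set mN := \sum_i (spread cN i * tu i) *: m i in mE.
have zN : (dot lN mN <= 0) -> cN = 0.
  move=> D0; apply: spread_eq0; apply: (coherent_definite cohN) => //; first exact: spread_out.
    by rewrite spread_sum.
  by rewrite mulN1r oppr_ge0.
have zP : (0 <= dot lN mN) -> cP = 0.
  move=> D0; apply: spread_eq0; apply: (coherent_definite cohP) => //; first exact: spread_out.
    by rewrite spread_sum.
  by rewrite mul1r lE mE dotNl dotNr opprK.
have [D0|D0] := lerP 0 (dot lN mN).
  have cP0 := zP D0; have cN0 : cN = 0.
    apply: zN; have := lE; rewrite cP0.
    rewrite big1 => [/eqP|i _]; last first.
      by rewrite /spread big1 ?mul0r ?scale0r // => k _; rewrite mxE.
    by rewrite eq_sym oppr_eq0 => /eqP->; rewrite dot0l.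
  by rewrite cP0 cN0 row_mx0 eqxx in c0.
have cN0 := zN (ltW D0).
suff : lN = 0 by move=> lN0; rewrite lN0 dot0l ltxx in D0.
rewrite /lN big1 // => i _.
by rewrite /spread big1 ?mul0r ?scale0r // => k _; rewrite cN0 mxE.
Qed.
End Lines.

(** * The isotropy argument *)

Section Isotropy.
Context {R : realType}.

Lemma tr_outer d (u v u' v' : 'rV[R]_d) :
  \tr (u^T *m v *m (u'^T *m v')) = dot v u' * dot v' u.
Proof.
rewrite mulmxA -(mulmxA u^T) dot_mx mul_mx_scalar -scalemxAl linearZ /=.
by rewrite mxtrace_mulC dot_mx mxtrace_scalar mulr1n.
Qed.

Lemma tr_outer1 d (u v : 'rV[R]_d) : \tr (u^T *m v) = dot u v.
Proof. by rewrite mxtrace_mulC dot_mx mxtrace_scalar mulr1n dotC. Qed.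

Lemma tr_sum_mul n d (c : 'I_n -> R) (A B : 'I_n -> 'M[R]_d) :
  \sum_i \sum_j c i * c j * \tr (A i *m B j) =
  \tr ((\sum_i c i *: A i) *m (\sum_j c j *: B j)).
Proof.
rewrite mulmx_suml linear_sum; apply: eq_bigr => i _.
rewrite mulmx_sumr linear_sum; apply: eq_bigr => j _.
by rewrite -scalemxAl -scalemxAr !linearZ /= mulrA.
Qed.

Lemma tr_mul_tr_eq0 d (A : 'M[R]_d) : \tr (A *m A^T) <= 0 -> A = 0.
Proof.
have E : \tr (A *m A^T) = \sum_i \sum_j A i j ^+ 2.
  by apply: eq_bigr => i _; rewrite mxE; apply: eq_bigr => j _; rewrite mxE.
have s0 i : 0 <= \sum_j A i j ^+ 2 by apply: sumr_ge0 => j _; exact: sqr_ge0.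
rewrite E => le0; have /eqP : \sum_i \sum_j A i j ^+ 2 = 0.
  by apply/eqP; rewrite eq_le le0 sumr_ge0.
rewrite psumr_eq0 // => /allP H; apply/matrixP => i j; rewrite mxE.
have := H i (mem_index_enum i); rewrite psumr_eq0 => [|k _]; last exact: sqr_ge0.
by move=> /allP/(_ j (mem_index_enum j)); rewrite sqrf_eq0 => /eqP.
Qed.

Lemma tr_mul_tr_ge0 d (A : 'M[R]_d) : 0 <= \tr (A *m A^T).
Proof.
apply: sumr_ge0 => i _; rewrite mxE; apply: sumr_ge0 => j _.
by rewrite mxE -expr2 sqr_ge0.
Qed.

(** Consider the quadratic form whose polarization takes the value
    [moment i j ^ 2 + dot (l i) (l j) ^ 2 - 1] on the symmetric squares of the
    Plücker vectors of two lines. All these squares span an isotropic subspace.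
    In the blocks [P = l^T l], [Q = l^T m], [S = m^T m] the form is
    [2 tr (Q Q) + 2 tr (P S) + tr (P P) - (tr P) ^ 2], and its negative index
    is 9: 3 from the antisymmetric part of [Q] and 6 from the hyperbolic pairing
    of [P] with [S]. So suitable 9 linear conditions meet the isotropic
    subspace only in 0. *)
Lemma touching_dependency n (l m : 'I_n -> 'rV[R]_3) : touching l m -> (9 < n)%N ->
  exists2 c : 'rV[R]_n, c != 0 &
    [/\ \sum_i c 0 i *: ((l i)^T *m l i) = 0,
        \sum_i c 0 i *: ((l i)^T *m m i) = 0 &
        \sum_i c 0 i *: ((m i)^T *m m i) = 0].
Proof.
move=> [l1 lm tch] n9.
(* The symmetric part of [Y] gives 6 of the conditions, the antisymmetric
   part the other 3. *)
pose Y i : 'M[R]_3 := 2^-1 *: ((l i)^T *m l i + (\tr ((l i)^T *m l i))%:M) - (m i)^T *m m i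
   + ((l i)^T *m m i - (m i)^T *m l i).
have [|c c0 cY] := @row_dependency _ _ _ (\matrix_i mxvec (Y i)).
  by apply: leq_ltn_trans (rank_leq_col _) n9.
exists c => //.
have {}cY : \sum_i c 0 i *: Y i = 0.
  apply: (can_inj mxvecK); rewrite linear0 linear_sum -[RHS]cY mulmx_sum_row.
  by apply: eq_bigr => i _; rewrite linearZ rowK.
set P := \sum_i c 0 i *: ((l i)^T *m l i).
set Q := \sum_i c 0 i *: ((l i)^T *m m i).
set S := \sum_i c 0 i *: ((m i)^T *m m i).
have PT : P^T = P.
  by rewrite /P linear_sum; apply: eq_bigr => i _; rewrite linearZ /= trmx_mul trmxK.
have ST : S^T = S.
  by rewrite /S linear_sum; apply: eq_bigr => i _; rewrite linearZ /= trmx_mul trmxK.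
have YE : 2^-1 *: (P + (\tr P)%:M) - S + (Q - Q^T) = 0.
  have trM : (\tr P)%:M = \sum_i c 0 i *: ((\tr ((l i)^T *m l i))%:M : 'M[R]_3).
    rewrite /P linear_sum raddf_sum; apply: eq_bigr => i _ /=.
    by rewrite linearZ scale_scalar_mx.
  have QTE : Q^T = \sum_i c 0 i *: ((m i)^T *m l i).
    by rewrite /Q linear_sum; apply: eq_bigr => i _; rewrite linearZ /= trmx_mul trmxK.
  rewrite -[RHS]cY trM QTE -big_split scaler_sumr -!sumrB -big_split.
  apply: eq_bigr => i _ /=.
  by rewrite -!scalerDr -!scalerBr scalerA (mulrC 2^-1) -scalerA -!scalerBr -scalerDr.
have QT : Q^T = Q.
  have YE' := congr1 trmx YE.
  rewrite !raddfD !raddfN /= !linearZ /= PT ST trmxK tr_scalar_mx trmx0 in YE'.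
  move: YE'; rewrite -scalerDr -YE => /addrI/matrixP E.
  by apply/matrixP => i j; have := E i j; rewrite !mxE; lra.
have SE : S = 2^-1 *: (P + (\tr P)%:M).
  by move: YE; rewrite QT subrr addr0 => /eqP; rewrite subr_eq0 => /eqP.
have key : 2 * \tr (P *m S) + 2 * \tr (Q *m Q) + \tr (P *m P) - \tr P * \tr P = 0.
  have E0 : \sum_i \sum_j c 0 i * c 0 j * (moment l m i j ^+ 2 + dot (l i) (l j) ^+ 2 - 1) = 0.
    by rewrite big1 // => i _; rewrite big1 // => j _; rewrite tch; ring.
  rewrite -[RHS]E0.
  have trP : \tr P = \sum_i c 0 i.
    rewrite /P linear_sum; apply: eq_bigr => i _.
    by rewrite linearZ /= tr_outer1 l1 mulr1.
  have -> : \tr P * \tr P = \sum_i \sum_j c 0 i * c 0 j * 1.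
    rewrite trP mulr_suml; apply: eq_bigr => i _; rewrite mulr_sumr.
    by apply: eq_bigr => j _; rewrite mulr1.
  have -> : 2 * \tr (P *m S) = \tr (P *m S) + \tr (S *m P).
    by rewrite (mxtrace_mulC S) mulr_natl mulr2n.
  rewrite -!tr_sum_mul mulr_sumr -!big_split -sumrB; apply: eq_bigr => i _ /=.
  rewrite mulr_sumr -!big_split -sumrB; apply: eq_bigr => j _ /=.
  rewrite !tr_outer /moment !(dotC (m j)) !(dotC (l j)); ring.
have trPS : 2 * \tr (P *m S) = \tr (P *m P) + \tr P * \tr P.
  rewrite SE -scalemxAr linearZ /= mulmxDr raddfD /= mul_mx_scalar linearZ /=.
  by field.
have P0 : P = 0.
  apply: tr_mul_tr_eq0; have := tr_mul_tr_ge0 Q; rewrite QT PT; lra.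
have Q0 : Q = 0.
  apply: tr_mul_tr_eq0; have := tr_mul_tr_ge0 P; rewrite QT PT; lra.
by split=> //; rewrite SE P0 linear0 raddf0 addr0 scaler0.
Qed.

Lemma weighted_gram n a b (c : 'rV[R]_n) (X : 'M[R]_(n, a)) (Y : 'M_(n, b)) :
  X^T *m diag_mx c *m Y = \sum_k c 0 k *: ((row k X)^T *m row k Y).
Proof.
apply/matrixP => i j; rewrite mul_mx_diag mxE summxE; apply: eq_bigr => k _.
by rewrite !mxE big_ord1 !mxE; ring.
Qed.

(** The column space of [X] is totally isotropic for the nondegenerate form
    with matrix [diag_mx c]. *)
Lemma isotropic_rank n d (c : 'rV[R]_n) (X : 'M[R]_(n, d)) :
  (forall i, c 0 i != 0) -> X^T *m diag_mx c *m X = 0 -> (2 * \rank X <= n)%N.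
Proof.
move=> c0 /mulmx0_rank_max; rewrite mxrankMfree; last first.
  rewrite row_free_unit unitmxE det_diag unitfE; exact/prodf_neq0.
by rewrite mxrank_tr mul2n addnn.
Qed.

End Isotropy.

(** * The rank of few lines *)

Section RankLower.
Context {R : realType} {n : nat} (l m : 'I_n.+1 -> 'rV[R]_3).
Context (tch : touching l m) (skw : skew l m).

Let a := moment l m.

(** Signs that make all products with the base line [ord0] positive; [tu] makes
    them negative by reversing the base line only. *)
Let sg (j : 'I_n.+1) : R := if j == ord0 then 1 else Num.sg (a ord0 j).
Let tu (j : 'I_n.+1) : R := if j == ord0 then -1 else sg j.
Let pos : rel 'I_n.+1 := fun j k => 0 < sg j * sg k * a j k.

Let pos_sym : symmetric pos.
Proof. by move=> j k; rewrite /pos /a momentC (mulrC (sg j)). Qed.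

Let sg2 j : sg j ^+ 2 = 1.
Proof.
rewrite /sg; case: eqP => [_|/eqP]; first by rewrite expr1n.
by rewrite eq_sym => /skw; rewrite sqr_sg => ->.
Qed.

Let sg0 : sg ord0 = 1. Proof. by rewrite /sg eqxx. Qed.

Let absE j k : j != k -> `|sg j * sg k * a j k| = Num.sqrt (1 - dot (l j) (l k) ^+ 2).
Proof.
move=> jk; have [_ _ <-] := tch; rewrite sqrtr_sqr !normrM.
have s1 i : `|sg i| = 1.
  by apply/eqP; rewrite -(@eqrXn2 _ 2) // expr1n -normrX sg2 normr1.
by rewrite !s1 !mul1r.
Qed.

Let base j : j != ord0 -> sg j * a ord0 j = Num.sqrt (1 - dot (l ord0) (l j) ^+ 2).
Proof.
move=> j0; rewrite -absE 1?eq_sym // !normrM /sg eqxx (negPf j0) normr1 mul1r.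
have a0 : a ord0 j != 0 by apply: skw; rewrite eq_sym.
by rewrite normr_sg a0 mul1r normrEsg.
Qed.

Let coherent_clique (P : {set 'I_n.+1}) : P \subset [set~ ord0] -> clique pos P ->
  coherent l m 1 sg (ord0 |: P).
Proof.
move=> /fintype.subsetP P0 cP; split=> // i j.
have out k : k \in P -> k != ord0 by move/P0; rewrite !inE.
rewrite mul1r => /setU1P[->|iP] /setU1P[->|jP]; rewrite ?eqxx // => ij.
- by rewrite -base ?out // sg0 mul1r.
- by rewrite momentC (dotC (l i)) -base ?out // sg0 mulr1.
- by rewrite -absE // ger0_norm //; apply/ltW/cP.
Qed.

Let coherent_coclique (N : {set 'I_n.+1}) : N \subset [set~ ord0] -> clique (codual pos) N ->
  coherent l m (-1) tu (ord0 |: N).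
Proof.
move=> /fintype.subsetP N0 cN; split=> [i|i j].
  by rewrite /tu; case: eqP => // _; rewrite sqrrN expr1n.
have out k : k \in N -> k != ord0 by move/N0; rewrite !inE.
rewrite mulN1r => /setU1P[->|iN] /setU1P[->|jN]; rewrite ?eqxx // => ij.
- by rewrite -base ?out // /tu eqxx (negPf (out _ jN)) mulN1r mulNr.
- rewrite momentC (dotC (l i)) -base ?out // /tu eqxx (negPf (out _ iN)).
  by rewrite mulrN1 mulNr.
- rewrite /tu (negPf (out _ iN)) (negPf (out _ jN)) -absE // ler0_norm ?opprK //.
  by rewrite leNgt; apply: cN.
Qed.

Let cardU1 (P : {set 'I_n.+1}) : P \subset [set~ ord0] -> #|ord0 |: P| = #|P|.+1.
Proof.
move=> /fintype.subsetP P0; rewrite cardsU1; suff -> : ord0 \notin P by [].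
by apply/negP => /P0; rewrite !inE eqxx.
Qed.

(** With all products with the base line normalized to one sign, a clique of
    positive products among the other lines extends by the base line to a
    coherent set, and so does a clique of negative products. By [coherent_rank]
    the rank is at least the sum of the sizes of two such cliques, none of which
    has more than three elements. The Ramsey numbers R(2,q) = q, R(3,3) = 6 and
    R(3,4) = 9 make this sum at least 2, 4, 5, 6 for at least 1, 3, 7, 9 lines
    besides the base line. *)
Lemma rank_lower : (n < 10)%N -> (n.+1 < 2 * \rank (plucker l m))%N.
Proof.
move=> n10; set V := [set~ ord0 : 'I_n.+1].
have cV : #|V| = n by rewrite cardsC1 card_ord.
have one2 : (1 : R) ^+ 2 = 1 by rewrite expr1n.
have mone2 : (-1 : R) ^+ 2 = 1 by rewrite sqrrN expr1n.
have P3 (P : {set 'I_n.+1}) : P \subset V -> clique pos P -> (#|P| <= 3)%N.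
  move=> PV cP; have := coherent_le4 tch skw one2 (coherent_clique PV cP).
  by rewrite cardU1.
have N3 (N : {set 'I_n.+1}) : N \subset V -> clique (codual pos) N -> (#|N| <= 3)%N.
  move=> NV cN; have := coherent_le4 tch skw mone2 (coherent_coclique NV cN).
  by rewrite cardU1.
have PN (P N : {set 'I_n.+1}) :
    P \subset V -> clique pos P -> N \subset V -> clique (codual pos) N ->
    (#|P| + #|N| <= \rank (plucker l m))%N.
  move=> PV cP NV cN.
  have := coherent_rank tch skw (coherent_clique PV cP) (coherent_coclique NV cN).
  by rewrite !cardU1 //; lia.
have arr p q : (forall r : rel 'I_n.+1, symmetric r -> arrows V r p q) ->
    arrows V pos p q /\ arrows V pos q p.
  move=> H; split; [exact: H|apply: arrows_codual].
  by apply: H => y z; rewrite /codual pos_sym.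
case: (posnP n) => [n0|n_gt0].
  have : plucker l m != 0.
    apply/eqP => /matrixP/(_ ord0) X0; have [l1 _ _] := tch.
    have /eqP : l ord0 = 0.
      apply/rowP => k; have := X0 (lshift 3 k).
      by rewrite mxE row_mxEl !mxE => ->.
    by rewrite -dot_eq0 l1 oner_eq0.
  by rewrite -mxrank_eq0; move: (\rank _) => r; lia.
have [x xV] : exists x, x \in V by apply/card_gt0P; rewrite cV.
have xs : [set x] \subset V by rewrite finset.sub1set.
have xP := @clique1 _ pos x; have xN := @clique1 _ (codual pos) x.
have sing (P : {set 'I_n.+1}) : P \subset V -> clique pos P -> (#|P|.+1 <= \rank (plucker l m))%N.
  by move=> PV cP; have := PN _ _ PV cP xs xN; rewrite cards1 addn1.
have sing' (N : {set 'I_n.+1}) :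
    N \subset V -> clique (codual pos) N -> (#|N|.+1 <= \rank (plucker l m))%N.
  by move=> NV cN; have := PN _ _ xs xP NV cN; rewrite cards1 add1n.
have [n9|n9] := leqP 9 n.
  have V9 : (9 <= #|V|)%N by rewrite cV.
  have [h34 h43] := arr 3%N 4%N (fun r sr => ramsey_34 sr V9).
  have [P [PV Pc cP]] : exists P : {set 'I_n.+1}, [/\ P \subset V, #|P| = 3%N & clique pos P].
    case: h34 => // -[N [NV Nc cN]]; by have := N3 N NV cN; rewrite Nc.
  have [N [NV Nc cN]] : exists N : {set 'I_n.+1},
      [/\ N \subset V, #|N| = 3%N & clique (codual pos) N].
    case: h43 => // -[Q [QV Qc cQ]]; by have := P3 Q QV cQ; rewrite Qc.
  by have := PN P N PV cP NV cN; rewrite Pc Nc; lia.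
have [n7|n7] := leqP 7 n.
  have V6 : (6 <= #|V|)%N by rewrite cV; lia.
  have V4 : (4 <= #|V|)%N by rewrite cV; lia.
  have [h24 h42] := arr 2%N 4%N (fun r sr => @ramsey_2 _ r 4 V sr isT V4).
  have [P [PV Pc cP]] : exists P : {set 'I_n.+1}, [/\ P \subset V, #|P| = 2%N & clique pos P].
    case: h24 => // -[N [NV Nc cN]]; by have := N3 N NV cN; rewrite Nc.
  have [N [NV Nc cN]] : exists N : {set 'I_n.+1},
      [/\ N \subset V, #|N| = 2%N & clique (codual pos) N].
    case: h42 => // -[Q [QV Qc cQ]]; by have := P3 Q QV cQ; rewrite Qc.
  case: (ramsey_33 pos_sym V6) => -[Q [QV Qc cQ]].
    by have := PN Q N QV cQ NV cN; rewrite Qc Nc; lia.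
  by have := PN P Q PV cP QV cQ; rewrite Pc Qc; lia.
have [n3|n3] := leqP 3 n.
  have V3 : (3 <= #|V|)%N by rewrite cV.
  have [h23 h32] := arr 2%N 3%N (fun r sr => @ramsey_2 _ r 3 V sr isT V3).
  suff : (4 <= \rank (plucker l m))%N by lia.
  case: h32 => -[P [PV Pc cP]]; first by have := sing P PV cP; rewrite Pc.
  case: h23 => -[N [NV Nc cN]]; last by have := sing' N NV cN; rewrite Nc.
  by have := PN N P NV cN PV cP; rewrite Pc Nc.
by have := PN _ _ xs xP xs xN; rewrite cards1; lia.
Qed.
End RankLower.

Lemma rank_gt_half (R : realType) n (l m : 'I_n -> 'rV[R]_3) :
  touching l m -> skew l m -> (0 < n <= 10)%N -> (n < 2 * \rank (plucker l m))%N.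
Proof. by case: n l m => [//|n] l m tch skw /rank_lower; apply. Qed.

(** A linear relation between the symmetric squares of the Plücker vectors
    makes the columns of coordinates isotropic on its support, so that the lines
    of the support have rank at most half their number. *)
Lemma no_ten_skew (R : realType) (l m : 'I_10 -> 'rV[R]_3) :
  touching l m -> ~ skew l m.
Proof.
move=> tch skw; have [//|c c0 [P0 Q0 S0]] := touching_dependency tch.
pose S := [set i | c 0 i != 0]%SET.
have [i iS] : exists i, i \in S.
  by move/rV0Pn: c0 => [i ci]; exists i; rewrite inE.
pose l' (k : 'I_#|S|) := l (enum_val k); pose m' (k : 'I_#|S|) := m (enum_val k).
have tch' : touching l' m'.
  by have [l1 lm h] := tch; split=> *; rewrite ?l1 ?lm //; apply: h.
have skw' : skew l' m'.
  by move=> j k jk; apply: skw; apply: contra_neq jk; apply: enum_val_inj.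
have := @rank_gt_half _ _ _ _ tch' skw'.
have S10 : (#|S| <= 10)%N by rewrite -[leqRHS](card_ord 10) max_card.
have S0' : (0 < #|S|)%N by apply/card_gt0P; exists i.
rewrite S0' S10 => /(_ isT).
apply/negP; rewrite -leqNgt.
pose c' := \row_(k < #|S|) c 0 (enum_val k).
apply: (@isotropic_rank _ _ _ c').
  by move=> k; rewrite mxE; have := enum_valP k; rewrite inE.
have sub a b (F : 'I_10 -> 'M[R]_(a, b)) : \sum_i c 0 i *: F i = 0 ->
    \sum_k c' 0 k *: F (enum_val k) = 0.
  move=> s0; rewrite -[RHS]s0 (bigID (mem S)) /= [X in _ = _ + X]big1 ?addr0; last first.
    by move=> j; rewrite inE negbK => /eqP->; rewrite scale0r.
  rewrite [RHS]big_enum_val; apply: eq_bigr => k _; by rewrite mxE.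
rewrite weighted_gram; under eq_bigr do rewrite !rowK.
apply: (sub _ _ (fun i => (row_mx (l i) (m i))^T *m row_mx (l i) (m i))).
under eq_bigr do rewrite tr_row_mx mul_col_row scale_block_mx.
have -> : \sum_i block_mx (c 0 i *: ((l i)^T *m l i)) (c 0 i *: ((l i)^T *m m i))
       (c 0 i *: ((m i)^T *m l i)) (c 0 i *: ((m i)^T *m m i)) =
   block_mx (\sum_i c 0 i *: ((l i)^T *m l i)) (\sum_i c 0 i *: ((l i)^T *m m i))
     (\sum_i c 0 i *: ((m i)^T *m l i)) (\sum_i c 0 i *: ((m i)^T *m m i)).
  elim: (index_enum _) => [|j s IH]; first by rewrite !big_nil block_mx0.
  by rewrite !big_cons IH add_block_mx.
have QT0 : \sum_i c 0 i *: ((m i)^T *m l i) = 0.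
  rewrite -[RHS](trmx0 R 3 3) -[in RHS]Q0 [RHS]linear_sum; apply: eq_bigr => j _.
  by rewrite linearZ /= trmx_mul trmxK.
by rewrite P0 Q0 S0 QT0 block_mx0.
Qed.

(** * Cross products *)

Section Cross.
Context {R : realType}.
Implicit Types u v w x : 'rV[R]_3.

(** Indices are taken modulo 3. *)
Definition cross u v : 'rV[R]_3 := \row_k
  (u 0 (k + 1) * v 0 (k + 2%:R) - u 0 (k + 2%:R) * v 0 (k + 1)).

Lemma dot3 u v : dot u v = u 0 0 * v 0 0 + u 0 1 * v 0 1 + u 0 2%:R * v 0 2%:R.
Proof.
rewrite /dot !big_ord_recl big_ord0 addr0 addrA.
by congr (_ * _ + _ * _ + _ * _); congr (_ _ _); apply: val_inj.
Qed.

Lemma crossE u v :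
  [/\ cross u v 0 0 = u 0 1 * v 0 2%:R - u 0 2%:R * v 0 1,
      cross u v 0 1 = u 0 2%:R * v 0 0 - u 0 0 * v 0 2%:R &
      cross u v 0 2%:R = u 0 0 * v 0 1 - u 0 1 * v 0 0].
Proof.
by split; rewrite mxE; congr (_ * _ - _ * _); congr (_ _ _); apply: val_inj.
Qed.

Lemma dot_cross_self u v : dot u (cross v u) = 0.
Proof. by have [a b c] := crossE v u; rewrite !dot3 a b c; ring. Qed.

Lemma lagrange u v : dot (cross u v) (cross u v) =
  dot u u * dot v v - dot u v ^+ 2.
Proof. by have [a b c] := crossE u v; rewrite !dot3 a b c; ring. Qed.

Lemma triple_gram x u v : dot x u = 0 -> dot x v = 0 ->
  dot x (cross u v) ^+ 2 = dot x x * (dot u u * dot v v - dot u v ^+ 2).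
Proof.
move=> xu xv; have [a b c] := crossE u v.
have : dot x (cross u v) ^+ 2 = dot x x * (dot u u * dot v v - dot u v ^+ 2)
  - dot x u * (dot x u * dot v v - dot u v * dot x v)
  - dot x v * (dot x v * dot u u - dot u v * dot x u).
  by rewrite !dot3 a b c; ring.
by rewrite xu xv !mul0r !subr0.
Qed.

(** Both [u] and [v] are orthogonal to [w], so [cross u v] is a multiple of [w]. *)
Lemma triple_along w u v x : dot w w = 1 -> dot u w = 0 -> dot v w = 0 ->
  dot x (cross u v) = dot w (cross u v) * dot x w.
Proof.
move=> w1 uw vw.
have : dot x (cross u v) * dot w w = dot w (cross u v) * dot x w +
   dot u w * dot x (cross w v) - dot v w * dot x (cross w u).
  have [a b c] := crossE u v; have [a' b' c'] := crossE w v.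
  by have [a'' b'' c''] := crossE w u; rewrite !dot3 a b c a' b' c' a'' b'' c''; ring.
by rewrite w1 uw vw !mul0r subr0 addr0 mulr1.
Qed.

Lemma moment_cross l p l' p' :
  dot l (cross p' l') + dot (cross p l) l' = dot (p - p') (cross l l').
Proof.
have [a b c] := crossE p' l'; have [a' b' c'] := crossE p l.
have [a'' b'' c''] := crossE l l'.
by rewrite !dot3 a b c a' b' c' a'' b'' c'' !mxE; ring.
Qed.

Lemma crossBl u v w : cross (u - v) w = cross u w - cross v w.
Proof. by apply/rowP => k; rewrite !mxE; ring. Qed.

Lemma crossDl u v w : cross (u + v) w = cross u w + cross v w.
Proof. by apply/rowP => k; rewrite !mxE; ring. Qed.

Lemma crossZl a u w : cross (a *: u) w = a *: cross u w.
Proof. by apply/rowP => k; rewrite !mxE; ring. Qed.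

Lemma crossZr a u w : cross u (a *: w) = a *: cross u w.
Proof. by apply/rowP => k; rewrite !mxE; ring. Qed.

Lemma cross_self u : cross u u = 0.
Proof. by apply/rowP => k; rewrite !mxE; ring. Qed.
End Cross.

(** * The distance of two lines *)

Local Open Scope classical_set_scope.
Local Open Scope card_scope.
Local Open Scope ring_scope.

Section Distance.
Context {R : realType}.
Implicit Types u v w p l : 'rV[R]_3.

Lemma dot_sqrD v w : dot (v + w) (v + w) = dot v v + 2 * dot v w + dot w w.
Proof. by rewrite !dotE (dotC w v); ring. Qed.

Lemma norm2E v : norm2 v = Num.sqrt (dot v v).
Proof. by congr Num.sqrt; apply: eq_bigr => k _; rewrite expr2. Qed.

Definition line l p : set 'rV[R]_3 := [set t *: l + p | t in [set: R]].

Lemma is_line_unit L : is_line L -> exists lp, dot lp.1 lp.1 = 1 /\ L = line lp.1 lp.2.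
Proof.
move=> [p [l [l0 ->]]]; pose r := Num.sqrt (dot l l).
have r0 : r != 0 by rewrite sqrtr_eq0 -ltNge lt0r dot_eq0 l0 dot_ge0.
exists (r^-1 *: l, p); split=> /=.
  rewrite !dotE; have : r ^+ 2 = dot l l by rewrite sqr_sqrtr ?dot_ge0.
  by move=> <-; field.
apply/seteqP; split=> x /= [t _ <-].
  by exists (t * r) => //; rewrite scalerA mulfK.
by exists (t * r^-1) => //; rewrite scalerA.
Qed.

Lemma parallel_scale l l' : dot l l = 1 -> dot l' l' = 1 -> dot l l' ^+ 2 = 1 ->
  l' = dot l l' *: l.
Proof.
move=> l1 l1' g2; apply/eqP; rewrite -subr_eq0 -dot_eq0 !dotE l1 l1' (dotC l' l).
by apply/eqP; move: g2; rewrite expr2; lra.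
Qed.

(** The common perpendicular realizes the distance, by Pythagoras. *)
Lemma line_dist_perp l p l' p' s s' :
  let v := (s *: l + p) - (s' *: l' + p') in
  dot v l = 0 -> dot v l' = 0 -> line_dist (line l p) (line l' p') = norm2 v.
Proof.
move=> v vl vl'; rewrite /line_dist; set A := [set _ | _ in _ & _ in _].
have Av : A (norm2 v).
  by exists (s *: l + p); [exists s|exists (s' *: l' + p'); first by exists s'].
have lbA : lbound A (norm2 v).
  move=> _ [_ [t _ <-]] [_ [t' _ <-] <-]; rewrite !norm2E ler_wsqrtr //.
  set z := _ - _; pose y := (t - s) *: l - (t' - s') *: l'.
  have -> : z = v + y.
    by apply/rowP => k; rewrite !mxE; ring.
  have vy : dot v y = 0 by rewrite /y dotDr dotNr !dotZr vl vl'; ring.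
  by rewrite (dot_sqrD v y) vy mulr0 addr0 lerDl dot_ge0.
apply/eqP; rewrite eq_le; apply/andP; split.
  by apply: ge_inf => //; exists (norm2 v).
by apply: lb_le_inf => //; exists (norm2 v).
Qed.

Lemma common_perp l p l' p' : dot l l = 1 -> dot l' l' = 1 -> exists s s',
  let v := (s *: l + p) - (s' *: l' + p') in dot v l = 0 /\ dot v l' = 0.
Proof.
move=> l1 l1'; set g := dot l l'; set a := dot (p - p') l; set b := dot (p - p') l'.
have [g2|g2] := eqVneq (g ^+ 2) 1.
  exists (- a), 0 => v.
  have vl : dot v l = 0 by rewrite /v /a !dotE l1; ring.
  by split=> //; rewrite (parallel_scale l1 l1' g2) dotZr vl mulr0.
have g0 : 1 - g ^+ 2 != 0 by rewrite subr_eq0 eq_sym.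
(* Cramer's rule for the two orthogonality equations. *)
exists ((g * b - a) / (1 - g ^+ 2)), ((b - g * a) / (1 - g ^+ 2)) => v.
have E z : dot v z = (g * b - a) / (1 - g ^+ 2) * dot l z + dot (p - p') z
    - (b - g * a) / (1 - g ^+ 2) * dot l' z.
  by rewrite /v !dotE; ring.
by split; rewrite E ?l1 ?l1' -/a -/b ?(dotC l' l) -/g; field.
Qed.

(** The second part is the distance condition that the Plücker form loses for
    parallel lines. *)
Lemma unit_distance l p l' p' : dot l l = 1 -> dot l' l' = 1 ->
  line_dist (line l p) (line l' p') = 1 ->
  (dot l (cross p' l') + dot (cross p l) l') ^+ 2 = 1 - dot l l' ^+ 2 /\
  (dot l l' ^+ 2 = 1 ->
    dot (cross p l - dot l l' *: cross p' l') (cross p l - dot l l' *: cross p' l') = 1).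
Proof.
move=> l1 l1' d1; have [s [s' [vl vl']]] := common_perp p p' l1 l1'.
have := line_dist_perp vl vl'; rewrite d1 norm2E.
set v := _ - _ in vl vl' *.
move=> /(congr1 (fun x => x ^+ 2)); rewrite sqr_sqrtr ?dot_ge0 // expr1n => v1.
have pE : p - p' = v - s *: l + s' *: l'.
  by apply/rowP => k; rewrite !mxE; ring.
clearbody v; split.
  rewrite moment_cross pE !dotE.
  have -> : dot l (cross l l') = 0.
    by have [a b c] := crossE l l'; rewrite dot3 a b c; ring.
  rewrite dot_cross_self !mulr0 subr0 addr0 triple_gram // -v1 l1 l1'.
  by rewrite !mul1r.
move=> g2; have l'E := parallel_scale l1 l1' g2.
have -> : cross p l - dot l l' *: cross p' l' = cross v l.
  have -> : dot l l' *: cross p' l' = cross p' l.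
    by rewrite [in cross _ _]l'E crossZr scalerA -expr2 g2 scale1r.
  rewrite -crossBl pE l'E !(crossBl, crossDl, crossZl) cross_self.
  by rewrite !scaler0 subr0 addr0.
by rewrite lagrange -v1 l1 vl expr0n /= subr0 mulr1.
Qed.
End Distance.

(** More than three vectors orthogonal to [l] are affinely dependent.
    For a relation [c] of sum zero, the sum of [c i c j |v i - v j| ^ 2] is 0
    because of the relation, and [- sum_i c i ^ 2] because all distances are 1. *)
Lemma unit_distance_plane (R : realType) n (l : 'rV[R]_3) (v : 'I_n -> 'rV[R]_3) :
  l != 0 -> (forall i, dot (v i) l = 0) ->
  (forall i j, i != j -> dot (v i - v j) (v i - v j) = 1) -> (n <= 3)%N.
Proof.
move=> l0 vl vd; rewrite leqNgt; apply/negP => n3.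
pose M : 'M[R]_(n, 1 + 3) := \matrix_k row_mx 1%:M (v k).
have [|c c0 [c1 cv]] := @affine_dependency _ _ _ v.
  have /mulmx0_rank_max : M *m (row_mx (0 : 'M[R]_1) l)^T = 0.
    apply/row_matrixP => k; rewrite row_mul rowK tr_row_mx mul_row_col trmx0.
    by rewrite mulmx0 add0r dot_mx vl row0 raddf0.
  rewrite mxrank_tr rank_row_0mx rank_rV l0 -/M; lia.
pose D i j := dot (v i - v j) (v i - v j).
have E1 : \sum_i \sum_j c 0 i * c 0 j * D i j = 0.
  have E i : \sum_j c 0 i * c 0 j * D i j = c 0 i * \sum_j c 0 j * dot (v j) (v j).
    transitivity (\sum_j (c 0 i * (c 0 j * dot (v j) (v j)) +
       (c 0 i * dot (v i) (v i) * c 0 j - 2 * c 0 i * dot (v i) (c 0 j *: v j)))).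
      apply: eq_bigr => j _; rewrite /D !dotE (dotC (v j) (v i)); ring.
    rewrite big_split sumrB -!mulr_sumr -dot_sumr c1 cv /=.
    by rewrite dotC dot0l !mulr0 subr0 addr0.
  by under eq_bigr do rewrite E; rewrite -mulr_suml c1 mul0r.
have E2 : \sum_i \sum_j c 0 i * c 0 j * D i j = - \sum_i c 0 i ^+ 2.
  rewrite -sumrN; apply: eq_bigr => i _.
  transitivity (\sum_j (c 0 i * c 0 j - (if j == i then c 0 i ^+ 2 else 0))).
    apply: eq_bigr => j _; have [->|ji] := eqVneq j i.
      by rewrite /D subrr dot0l; ring.
    by rewrite /D vd 1?eq_sym //; ring.
  rewrite sumrB -mulr_sumr c1 mulr0 -big_mkcond big_pred1_eq sub0r //.
case/negP: c0; apply/eqP/rowP => i; rewrite mxE; apply/eqP.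
have : \sum_i c 0 i ^+ 2 = 0 by lra.
move/eqP; rewrite psumr_eq0 => [/allP/(_ i (mem_index_enum i))|j _]; last exact: sqr_ge0.
by rewrite sqrf_eq0.
Qed.

(** * Parallel lines *)

Section Parallel.
Context {R : realType} (l p : 'I_10 -> 'rV[R]_3).
Let m i := cross (p i) (l i).
Context (tch : touching l m).
Context (par : forall i j, i != j -> dot (l i) (l j) ^+ 2 = 1 ->
  dot (m i - dot (l i) (l j) *: m j) (m i - dot (l i) (l j) *: m j) = 1).

(** Parallel lines meet an orthogonal plane in points at mutual distance 1; the
    moments are these points turned by a right angle, once all lines are
    oriented like [l a]. *)
Lemma parallel_class_le3 (A : {set 'I_10}) (a : 'I_10) :
  {in A, forall i, dot (l a) (l i) ^+ 2 = 1} -> (#|A| <= 3)%N.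
Proof.
move=> pA; have [l1 lm _] := tch.
have lE i : i \in A -> l i = dot (l a) (l i) *: l a.
  by move=> iA; apply: parallel_scale => //; apply: pA.
apply: (@unit_distance_plane _ _ (l a)
  (fun k : 'I_#|A| => dot (l a) (l (enum_val k)) *: m (enum_val k))).
- by rewrite -dot_eq0 l1 oner_neq0.
- move=> k; have kA := enum_valP k; set i := enum_val k in kA *.
  have := lm i; rewrite {1}(lE i kA) !dotE => h.
  by rewrite (dotC (m i)).
move=> j k jk; have jA := enum_valP j; have kA := enum_valP k.
have : enum_val j != enum_val k by apply: contra_neq jk; apply: enum_val_inj.
set i := enum_val j in jA *; set i' := enum_val k in kA * => ii'.
have gE : dot (l i) (l i') = dot (l a) (l i) * dot (l a) (l i').
  by rewrite {1}(lE i jA) dotZl.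
have g2 : dot (l i) (l i') ^+ 2 = 1 by rewrite gE exprMn !pA // mulr1.
rewrite -(par ii' g2) gE; have := pA _ jA.
set s := dot (l a) (l i); set t := dot (l a) (l i') => s2.
rewrite !dotE (dotC (m i')).
set x := dot (m i) (m i); set y := dot (m i) (m i'); set z := dot (m i') (m i').
apply/eqP; rewrite -subr_eq0; apply/eqP.
transitivity ((s ^+ 2 - 1) * (x - t ^+ 2 * z)); first by ring.
by rewrite s2 subrr mul0r.
Qed.

(** All lines are parallel to one plane, so the distance of two nonparallel
    ones is the difference of their heights above it. Three heights cannot
    differ pairwise by 1. *)
Lemma coplanar_directions w i j k : dot w w = 1 ->
  (forall a, dot w (l a) = 0) -> moment l m i j != 0 -> moment l m i k != 0 ->
  moment l m j k != 0 -> False.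
Proof.
move=> w1 lw; have [l1 _ tm] := tch.
have h a b : moment l m a b != 0 -> (dot (p a) w - dot (p b) w) ^+ 2 = 1.
  have mE : moment l m a b = dot w (cross (l a) (l b)) * (dot (p a) w - dot (p b) w).
    rewrite /moment /m moment_cross (triple_along _ w1) 1?dotC ?lw //.
    by rewrite !dotE.
  have : dot w (cross (l a) (l b)) ^+ 2 = moment l m a b ^+ 2.
    rewrite tm; have := lagrange (l a) (l b); rewrite !l1 mulr1 => <-.
    by rewrite (triple_along (cross _ _) w1) ?(dotC _ w) ?lw // expr2.
  move=> E m0; move: E; rewrite mE exprMn => /esym E.
  have /mulfI : dot w (cross (l a) (l b)) ^+ 2 != 0.
    by rewrite sqrf_eq0; apply: contraNneq m0 => z; rewrite mE z mul0r.
  by apply; rewrite E mulr1.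
move=> /h hij /h hik /h; move: hij hik; rewrite !expr2; nra.
Qed.

(** If two lines are parallel, with [w] the unit normal of their plane, then
    every line is parallel to this plane: the projection of a third line along
    the two would otherwise separate two points at distance 1 and be at distance
    1 from both. By [coplanar_directions] there are then at most two classes of
    parallel lines, with at most three lines each. *)
Lemma no_parallel : skew l m.
Proof.
move=> i1 i2 i12; apply/negP => /eqP m0; have [l1 lm tm] := tch.
have g2 : dot (l i1) (l i2) ^+ 2 = 1.
  by have := tm i1 i2; rewrite m0 expr0n /=; lra.
have l2E := parallel_scale (l1 i1) (l1 i2) g2.
have w1 := par i12 g2; set g := dot (l i1) (l i2) in g2 l2E w1.
set w := m i1 - g *: m i2 in w1.
have wl1 : dot w (l i1) = 0.
  have h : l i1 = g *: l i2 by rewrite l2E scalerA -expr2 g2 scale1r.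
  rewrite /w !dotE (dotC (m i1)) lm {1}h !dotE (dotC (m i2)) lm; ring.
have wl j : dot w (l j) = 0.
  have g2j : dot (l i2) (l j) = g * dot (l i1) (l j) by rewrite l2E dotZl.
  have wE : dot w (l j) = moment l m i1 j - g * moment l m i2 j.
    rewrite /w /moment l2E !dotE.
    have -> : g * (g * dot (l i1) (m j) + dot (m i2) (l j)) =
      g ^+ 2 * dot (l i1) (m j) + g * dot (m i2) (l j) by ring.
    by rewrite g2; ring.
  have sq : moment l m i1 j ^+ 2 = (g * moment l m i2 j) ^+ 2.
    by rewrite exprMn g2 mul1r !tm g2j exprMn g2 mul1r.
  have bes := bessel2 (l1 i1) w1 wl1 (l1 j).
  (* The second sign is the separating line, excluded by Bessel's inequality. *)
  have := tm i1 j; move: sq => /eqP; rewrite eqf_sqr => /orP[]/eqP E; move: wE; rewrite E.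
    by rewrite subrr.
  move=> wE t; have {}t : (g * moment l m i2 j) ^+ 2 = 1 - dot (l i1) (l j) ^+ 2.
    by rewrite -t sqrrN.
  apply/eqP; rewrite -sqrf_eq0 eq_le sqr_ge0 andbT.
  move: bes t wE; set x := dot w (l j); set y := dot (l i1) (l j).
  set z := g * _ => bes t wE; have {wE} : x ^+ 2 = 4 * z ^+ 2 by rewrite wE; ring.
  by rewrite t; nra.
pose C := [set j | dot (l i1) (l j) ^+ 2 == 1]%SET.
have C3 : (#|C| <= 3)%N.
  by apply: (@parallel_class_le3 _ i1) => j; rewrite inE => /eqP.
have cC := cardsC C; rewrite card_ord in cC.
have [b bC] : exists b, b \in ~: C by apply/card_gt0P; lia.
have : (#|~: C| <= 3)%N.
  apply: (@parallel_class_le3 _ b) => j jC.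
  apply/eqP; apply: contraT => bj.
  have nz x y : dot (l x) (l y) ^+ 2 != 1 -> moment l m x y != 0.
    by move=> h; rewrite -sqrf_eq0 tm subr_eq0 eq_sym.
  have [] := @coplanar_directions w i1 b j w1 wl; apply: nz => //.
    by move: bC; rewrite !inE.
  by move: jC; rewrite !inE.
lia.
Qed.
End Parallel.

(** * The bound *)

Theorem theorem1 (R : realType) (F : set (set 'rV[R]_3))
    (F_lines : forall L, F L -> is_line L)
    (F_dist1 : forall L L', F L -> F L' -> L <> L' -> line_dist L L' = 1) :
  F #<= `I_9.
Proof.
apply: contrapT => nF.
have F10 : `I_10 #<= F.
  have [/finite_setP[n Fn]|/infiniteP] := pselect (finite_set F).
    move: nF; rewrite (card_le_eql Fn) (card_le_eqr Fn) !card_le_II.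
    by move=> /negP; rewrite -ltnNge.
  by apply: card_le_trans; apply: subset_card_le.
have [f] := pcard_leP F10.
pose L (i : 'I_10) := f i.
have FL i : F (L i) by apply: funS; exact: ltn_ord.
have Linj i j : i != j -> L i <> L j.
  by move=> ij Lij; case/eqP: ij; apply: val_inj; apply: (@inj _ _ _ f) Lij;
    rewrite inE /=; apply: ltn_ord.
have [lp lpP] := choice (fun i => is_line_unit (F_lines _ (FL i))).
pose l i := (lp i).1; pose p i := (lp i).2.
have l1 i : dot (l i) (l i) = 1 by have [] := lpP i.
have d1 i j : i != j -> line_dist (line (l i) (p i)) (line (l j) (p j)) = 1.
  move=> ij; have [_ <-] := lpP i; have [_ <-] := lpP j.
  by apply: F_dist1 => //; apply: Linj.
have tch : touching l (fun i => cross (p i) (l i)).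
  split=> // [i|i j]; first exact: dot_cross_self.
  have [<-|ij] := eqVneq i j.
    by rewrite /moment (dotC (cross _ _)) dot_cross_self l1; ring.
  by have [] := unit_distance (l1 i) (l1 j) (d1 _ _ ij).
apply: (no_ten_skew tch); apply: no_parallel => // i j ij.
by have [] := unit_distance (l1 i) (l1 j) (d1 _ _ ij).
Qed.
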